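(* Let $F:\mathbb{R}^n\to\mathbb{R}$ be a convex differentiable function with $X^*:=\operatorname{argmin} F\neq\emptyset$ and $F^*:=\inf F$. Let $\gamma\geq 1$ and $\alpha>0$, let $t_0>0$, and let $x:[t_0,+\infty)\to\mathbb{R}^n$ be a solution of $$\ddot{x}(t)+\frac{\alpha}{t}\dot{x}(t)+\nabla F(x(t))=0 .$$ If $F$ satisfies $\mathbf{H}_1(\gamma)$ and $\mathbf{H}_2(2)$ with $\gamma\leq 2$, if $F$ has a unique minimizer, and if $\alpha>1+\frac{2}{\gamma}$, then, as $t\to+\infty$, $$F(x(t))-F^*=O\left(\frac{1}{t^{\frac{2\gamma\alpha}{\gamma+2}}}\right).$$ Moreover this decay is optimal in the sense that, for any $\gamma\in(1,2]$ and any $\alpha>1+\frac{2}{\gamma}$, the rate is achieved for the function $F:\mathbb{R}\to\mathbb{R}$, $F(x)=|x|^\gamma$: there exist $t_0>0$, a solution $x$ of the differential equation $\ddot{x}(t)+\frac{\alpha}{t}\dot{x}(t)+\nabla F(x(t))=0$ on $[t_0,+\infty)$ for this $F$, and a constant $K>0$ such that for any $T>0$ there exists $t\geq T$ with $F(x(t))-F^*\geq K\,t^{-\frac{2\gamma\alpha}{\gamma+2}}$.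
   Context: $\mathbb{R}^n$ carries the Euclidean scalar product $\langle\cdot,\cdot\rangle$ and norm $\|\cdot\|$; $B(x^*,r)$ is the open Euclidean ball of center $x^*$ and radius $r$; $d(x,X^* )$ is the distance from $x$ to $X^*$. For a convex differentiable $F:\mathbb{R}^n\to\mathbb{R}$ with $X^*=\operatorname{argmin}F\neq\emptyset$ and $F^*=\inf F$: Hypothesis $\mathbf{H}_1(\gamma)$ ($\gamma\geq 1$): for any minimizer $x^*\in X^*$ there exists $\eta>0$ such that $$\forall x\in B(x^*,\eta),\quad F(x)-F^*\leq\frac{1}{\gamma}\langle\nabla F(x),x-x^*\rangle .$$ Hypothesis $\mathbf{H}_2(r)$ ($r\geq 1$): for any minimizer $x^*\in X^*$ there exist $K>0$ and $\varepsilon>0$ such that $$\forall x\in B(x^*,\varepsilon),\quad K\,d(x,X^* )^r\leq F(x)-F^* .$$ Standing assumption: for any initial conditions $(x_0,v_0)\in\mathbb{R}^n\times\mathbb{R}^n$, the Cauchy problem for the differential equation with $x(t_0)=x_0$, $\dot x(t_0)=v_0$ has a unique global solution on $[t_0,+\infty)$. *)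

(* Defs.v *)
From mathcomp Require Import all_boot all_order all_algebra.
From mathcomp Require Import all_classical all_reals all_analysis.
Set Implicit Arguments.
Unset Strict Implicit.
Unset Printing Implicit Defensive.
Import Order.TTheory GRing.Theory Num.Theory.
Import numFieldNormedType.Exports.
Local Open Scope classical_set_scope.
Local Open Scope ring_scope.

(* The library norm on 'rV[R]_n is the sup norm; the Euclidean structure is
   therefore introduced here.  The sup norm is only used through the topology
   it induces (limits, derivatives), which is the Euclidean one. *)
Definition dotv (R : realType) (n : nat) (u v : 'rV[R]_n) : R :=
  \sum_(i < n) u 0 i * v 0 i.

Definition enorm (R : realType) (n : nat) (u : 'rV[R]_n) : R :=
  Num.sqrt (dotv u u).

Definition eball (R : realType) (n : nat) (c : 'rV[R]_n) (r : R)
    : set 'rV[R]_n :=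
  [set x | enorm (x - c) < r].

(* [inf] is real-valued, with [inf set0 = 0]: meaningful for A nonempty. *)
Definition edistance (R : realType) (n : nat) (x : 'rV[R]_n)
    (A : set 'rV[R]_n) : R :=
  inf [set enorm (x - y) | y in A].

Definition grad (R : realType) (n : nat) (F : 'rV[R]_n -> R) (x : 'rV[R]_n)
    : 'rV[R]_n :=
  \row_(i < n) 'D_(delta_mx 0 i) F x.

Definition argmin (R : realType) (T : Type) (F : T -> R) : set T :=
  [set x | forall y, F x <= F y].

Definition minval (R : realType) (T : Type) (F : T -> R) : R := inf (range F).

Definition H1 (R : realType) (n : nat) (F : 'rV[R]_n -> R) (gamma : R) : Prop :=
  forall xs, argmin F xs ->
    exists2 eta : R, 0 < eta &
      forall x, eball xs eta x ->
        F x - minval F <= gamma^-1 * dotv (grad F x) (x - xs).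

Definition H2 (R : realType) (n : nat) (F : 'rV[R]_n -> R) (r : R) : Prop :=
  forall xs, argmin F xs ->
    exists K eps : R, [/\ 0 < K, 0 < eps &
      forall x, eball xs eps x ->
        K * edistance x (argmin F) `^ r <= F x - minval F].

(* [f'] is the derivative of the restriction of [f] to [t0, +oo): two-sided at
   t > t0, right derivative at t0.  Values of [f] before t0 are irrelevant. *)
Definition derivative_from (R : realType) (V : normedModType R) (t0 : R)
    (f f' : R -> V) : Prop :=
  forall t, t0 <= t ->
    (fun s => (s - t)^-1 *: (f s - f t))
      @ within [set s | t0 <= s] (t^') --> f' t.

(* [x] is a solution of x'' + (alpha / t) x' + G x = 0 on [t0, +oo), with
   velocity [v]; [G] stands for the gradient of the potential. *)
Definition is_solution (R : realType) (V : normedModType R) (G : V -> V)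
    (alpha t0 : R) (x v : R -> V) : Prop :=
  derivative_from t0 x v /\
  exists2 a : R -> V, derivative_from t0 v a &
    forall t, t0 <= t -> a t + (alpha / t) *: v t + G (x t) = 0.

(* Solutions are total functions, so uniqueness is agreement on [t0, +oo). *)
Definition well_posed (R : realType) (V : normedModType R) (G : V -> V)
    (alpha t0 : R) : Prop :=
  forall x0 v0 : V,
    (exists x v, [/\ is_solution G alpha t0 x v, x t0 = x0 & v t0 = v0]) /\
    (forall x v y w,
       is_solution G alpha t0 x v -> x t0 = x0 -> v t0 = v0 ->
       is_solution G alpha t0 y w -> y t0 = x0 -> w t0 = v0 ->
       forall t, t0 <= t -> x t = y t).

(* Makes [+oo] usable as the filter of the Landau notation [=O_]. *)
Canonical pinfty_nbhs_filter_on (R : numFieldType) :=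
  FilterType (pinfty_nbhs R) _.

(* Main.v *)
Require Import Defs.
From mathcomp Require Import all_boot all_order all_algebra.
From mathcomp Require Import all_classical all_reals all_analysis.
From mathcomp Require Import ring lra.
Set Implicit Arguments.
Unset Strict Implicit.
Unset Printing Implicit Defensive.
Import Order.TTheory GRing.Theory Num.Theory.
Import numFieldNormedType.Exports.
Local Open Scope classical_set_scope.
Local Open Scope ring_scope.

(** Write w = x - x*, f = F(x) - F*, and let v be the velocity.  Everything is
    driven by the Lyapunov function
      E(t) = t^2 f + 1/2 |lam w + t v|^2 + xi/2 |w|^2,
    whose derivative only involves f, g = <grad F(x), w>, |w|^2, <w, v> and
    |v|^2.  Since these five scalar functions satisfy the same differential
    identities for a vector trajectory and for a scalar one, the Lyapunov
    analysis is carried out on them alone ([damped_moments]).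

    With lam = 2 alpha / (gamma + 2), p = lam gamma - 2 and xi = - lam p / 2 the
    cross terms cancel ([energy_sharp]):
      t E' + p E = t^2 lam (gamma f - g) + (lam p / 4) (2 lam - p) |w|^2,
    and p + 2 = lam gamma is the announced exponent.

    Upper bound.  Convexity alone gives f = O(1/t) ([potential_decay]), so F
    reaches values smaller than its minimum over a small sphere around x*, and
    by convexity the trajectory is then trapped inside that sphere, where
    the two local hypotheses hold.  There gamma f <= g and |w|^2 <= B f; as E
    dominates t^2 f / 2 for large t, H = t^p E satisfies H' <= D t^-3 H.  The
    factor t^-3 is integrable, so H, hence t^(p + 2) f, is bounded
    ([upper_rate]).

    Optimality.  For F = |.|^gamma one has g = gamma f exactly, so H is
    nondecreasing, and it is positive for the data x = 0, v = 1.  If f were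
    eventually smaller than K t^-(p + 2) with K small, then t^lam x would stay
    bounded, while H >= c would force |lam x + t v| to be at least of order
    t^(-p/2), so that the derivative of t^lam x would stay away from 0: a
    contradiction ([lower_rate]).

    The gradient of |.|^gamma is not Lipschitz at 0 when gamma < 2, so the
    solution comes from a global Peano theorem ([peano_global]): Euler
    approximations are bounded on compact time intervals because the field has
    linear growth, and they converge pointwise along an ultrafilter finer than
    the filter at infinity.  The local consistency estimate [euler_local] passes
    to that pointwise limit and says directly that the limit is differentiable
    with the right derivative, so no equicontinuity argument is needed. *)

(** * Lyapunov analysis of the scalar moments of a trajectory *)

(** The scalar shadow of a trajectory after time t0: f is the excess of the
    potential, g = <grad F(x), w>, and W, P, Q stand for |w|^2, <w, v>, |v|^2.
    The existential h is <grad F(x), v>; it cancels in the derivative of the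
    energy, so it is not recorded.  The quadratic form is |a w + b v|^2. *)
Definition damped_moments (R : realType) (alpha t0 : R) (f g W P Q : R -> R) : Prop :=
  forall t, t0 < t ->
    (forall a b, 0 <= a ^+ 2 * W t + 2 * a * b * P t + b ^+ 2 * Q t) /\
    exists h, [/\ is_derive t 1 f h, is_derive t 1 W (2 * P t),
      is_derive t 1 P (Q t - alpha / t * P t - g t) &
      is_derive t 1 Q (- 2 * (alpha / t * Q t + h))].

Definition energy (R : realType) (lam xi : R) (f W P Q : R -> R) (t : R) : R :=
  t ^+ 2 * f t +
  2^-1 * (lam ^+ 2 * W t + 2 * lam * t * P t + t ^+ 2 * Q t) + xi / 2 * W t.

Lemma is_derive_nondecreasing (R : realType) (h dh : R -> R) (a : R) :
  (forall t, a <= t -> is_derive t 1 h (dh t)) ->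
  (forall t, a <= t -> 0 <= dh t) ->
  forall s t, a <= s -> s <= t -> h s <= h t.
Proof.
move=> hD dh0 s t as_ st.
have [||c + E] := @MVT_segment R h dh s t st.
- by move=> u; rewrite in_itv/= => /andP[su _]; apply: hD; lra.
- apply: derivable_within_continuous => u; rewrite in_itv/= => /andP[su _].
  by have /hD[] : a <= u by lra.
rewrite in_itv/= => /andP[sc _].
by rewrite -subr_ge0 E mulr_ge0 ?subr_ge0// dh0//; lra.
Qed.

(** Keeps the factor t out of the power, so that [field] can finish. *)
Lemma powR_predE (R : realType) (p t : R) : 0 < t -> t `^ p = t * t `^ (p - 1).
Proof.
move=> t0; rewrite -[X in X * _]powRr1 ?ltW// -powRD ?subrKC//.
by rewrite (gt_eqF t0) implybT.
Qed.

Lemma rate_exponent (R : realType) (gamma alpha : R) :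
  0 < gamma -> 1 + 2 / gamma < alpha ->
  exists lam, [/\ lam * (gamma + 2) = 2 * alpha,
    2 * gamma * alpha / (gamma + 2) = lam * gamma & 2 < lam * gamma].
Proof.
move=> g0 alphag; have gD0 : gamma + 2 != 0 by rewrite gt_eqF//; lra.
have lamE : 2 * alpha / (gamma + 2) * gamma = 2 * (gamma * alpha) / (gamma + 2).
  by field.
exists (2 * alpha / (gamma + 2)); split; first by rewrite divfK.
  by field.
rewrite lamE ltr_pdivlMr; last lra.
have : gamma * (1 + 2 / gamma) < gamma * alpha by rewrite ltr_pM2l.
by rewrite mulrDr mulr1 mulrCA divff ?gt_eqF// mulr1; lra.
Qed.

(** The bound 2 <= 2 lam - p amounts to lam (2 - gamma) >= 0; it is where
    gamma <= 2 enters, both for the sign of the remainder in the upper bound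
    and for the growth of t^lam x in the lower bound. *)
Lemma lyapunov_exponents (R : realType) (alpha gamma lam : R) :
  0 < gamma -> gamma <= 2 -> 2 < lam * gamma ->
  lam * (gamma + 2) = 2 * alpha ->
  let p := lam * gamma - 2 in
  [/\ 0 < p, 0 < lam, lam + p / 2 = alpha - 1 & 2 <= 2 * lam - p].
Proof.
move=> g0 g2 lg2 lgE p.
have lam0 : 0 < lam by rewrite -(pmulr_lgt0 _ g0); lra.
have : 0 <= lam * (2 - gamma) by rewrite mulr_ge0//; lra.
by rewrite /p; split; lra.
Qed.

(** The terms <grad F(x), v> coming from f' and from Q' cancel: this is why the
    potential carries the weight t^2. *)
Lemma is_derive_energy (R : realType) (alpha t0 lam xi t : R)
    (f g W P Q : R -> R) :
  0 <= t0 -> t0 < t -> damped_moments alpha t0 f g W P Q ->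
  is_derive t 1 (energy lam xi f W P Q)
    (t^-1 * (2 * t ^+ 2 * f t - lam * t ^+ 2 * g t
      + (lam * (lam + 1 - alpha) + xi) * t * P t
      + (lam + 1 - alpha) * t ^+ 2 * Q t)).
Proof.
move=> t00 t0t /(_ t t0t)[_ [h [fD WD PD QD]]].
have tn0 : t != 0 by rewrite gt_eqF//; lra.
have sqD := is_deriveX 2 (is_derive_id t (1 : R)).
have Pt := is_deriveM (is_deriveZ (2 * lam) (is_derive_id t (1 : R))) PD.
have := is_deriveD (is_deriveD (is_deriveM sqD fD)
  (is_deriveZ 2^-1 (is_deriveD (is_deriveD (is_deriveZ (lam ^+ 2) WD) Pt)
     (is_deriveM sqD QD)))) (is_deriveZ (xi / 2) WD).
move=> /is_derive_eq; apply.
rewrite /=/GRing.scale/= /GRing.exp /=.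
by rewrite !fctE; field.
Qed.

Lemma is_derive_powR_energy (R : realType) (alpha t0 lam xi p t : R)
    (f g W P Q : R -> R) :
  0 <= t0 -> t0 < t -> damped_moments alpha t0 f g W P Q ->
  is_derive t 1 (fun s => s `^ p * energy lam xi f W P Q s)
    (t `^ (p - 1) * (2 * t ^+ 2 * f t - lam * t ^+ 2 * g t
      + (lam * (lam + 1 - alpha) + xi) * t * P t
      + (lam + 1 - alpha) * t ^+ 2 * Q t + p * energy lam xi f W P Q t)).
Proof.
move=> t00 t0t M.
have t_gt0 : 0 < t by lra.
have := is_deriveM (is_derive1_powR p t_gt0)
  (is_derive_energy lam xi t00 t0t M).
move=> /is_derive_eq; apply.
rewrite /GRing.scale/=.
rewrite (powR_predE p t_gt0).
by field; rewrite gt_eqF.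
Qed.

Lemma damped_moments_ge0 (R : realType) (alpha t0 t : R) (f g W P Q : R -> R) :
  t0 < t -> damped_moments alpha t0 f g W P Q -> 0 <= W t /\ 0 <= Q t.
Proof.
move=> t0t /(_ t t0t)[S _].
have := S 1 0; have := S 0 1.
rewrite !(expr0n, expr1n, mulr0, mul0r, mul1r, add0r, addr0)/=.
by move=> -> ->.
Qed.

(** With lam = 1 and xi = alpha - 2 the derivative of E satisfies t E' <= t^2 f
    <= E, so E / t is nonincreasing, and t f <= E / t. *)
Lemma potential_decay (R : realType) (alpha t0 : R) (f g W P Q : R -> R) :
  2 <= alpha -> 0 < t0 -> damped_moments alpha t0 f g W P Q ->
  (forall t, t0 < t -> 0 <= f t) -> (forall t, t0 < t -> f t <= g t) ->
  exists C, forall t, t0 + 1 <= t -> f t <= C / t.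
Proof.
move=> alpha2 t00 M f0 fg.
pose H t := - (t `^ (-1) * energy 1 (alpha - 2) f W P Q t).
have HE t : t0 + 1 <= t ->
    t * f t <= - H t.
  move=> tge; have [W0 _] : 0 <= W t /\ 0 <= Q t by apply: damped_moments_ge0 M; lra.
  have t_gt0 : 0 < t by lra.
  rewrite /H opprK powR_inv1 ?(ltW t_gt0)// ler_pdivlMl// /energy.
  have [S _] : _ := M t ltac:(lra).
  have := S 1 t; rewrite expr1n mulr1 => S1.
  have : 0 <= (alpha - 2) / 2 * W t by rewrite mulr_ge0// divr_ge0//; lra.
  by lra.
exists (- H (t0 + 1)) => t tge.
have t_gt0 : 0 < t by lra.
rewrite ler_pdivlMr// mulrC (le_trans (HE _ tge))// lerN2.
apply: (@is_derive_nondecreasing _ H (fun t => - (t `^ (- 1 - 1) *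
  (2 * t ^+ 2 * f t - 1 * t ^+ 2 * g t
      + (1 * (1 + 1 - alpha) + (alpha - 2)) * t * P t
      + (1 + 1 - alpha) * t ^+ 2 * Q t + -1 * energy 1 (alpha - 2) f W P Q t)))
  (t0 + 1)) => // s sge.
  by apply: is_deriveN; apply: is_derive_powR_energy M; lra.
have [W0 Q0] : 0 <= W s /\ 0 <= Q s by apply: damped_moments_ge0 M; lra.
rewrite -mulrN mulr_ge0 ?powR_ge0// /energy.
have [S _] : _ := M s ltac:(lra).
have := S 1 s; rewrite expr1n mulr1 => S1.
have : 0 <= (alpha - 2) / 2 * W s by rewrite mulr_ge0// divr_ge0//; lra.
have : 0 <= (alpha - 2) * (s ^+ 2 * Q s) by rewrite !mulr_ge0 ?sqr_ge0//; lra.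
have : 0 <= s ^+ 2 * (g s - f s).
  by rewrite mulr_ge0 ?sqr_ge0// subr_ge0 fg//; lra.
by lra.
Qed.

(** The relation lam + p / 2 = alpha - 1 makes the |v|^2 terms of t E' and p E
    compensate, and xi = - lam p / 2 removes <w, v>.  What is left vanishes up
    to |w|^2 when g = gamma f and p + 2 = lam gamma. *)
Lemma energy_sharp (R : realType) (alpha lam p t : R) (f g W P Q : R -> R) :
  lam + p / 2 = alpha - 1 ->
  2 * t ^+ 2 * f t - lam * t ^+ 2 * g t
      + (lam * (lam + 1 - alpha) + - (lam * p / 2)) * t * P t
      + (lam + 1 - alpha) * t ^+ 2 * Q t
      + p * energy lam (- (lam * p / 2)) f W P Q t =
  t ^+ 2 * ((p + 2) * f t - lam * g t) + lam * p / 4 * (2 * lam - p) * W t.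
Proof.
move=> E; have -> : alpha = lam + p / 2 + 1 by lra.
by rewrite /energy; field.
Qed.

(** Since xi < 0 the energy need not be nonnegative at first; past T the growth
    bound W <= B f lets t^2 f absorb xi W, so that E >= t^2 f / 2.  The
    perturbation of H' is then at most D t^-3 H, and multiplying H by 1 + 1/t,
    whose derivative is - t^-2, restores monotonicity. *)
Lemma upper_rate (R : realType) (alpha gamma lam t1 B : R)
    (f g W P Q : R -> R) :
  1 <= gamma -> gamma <= 2 -> 2 < lam * gamma ->
  lam * (gamma + 2) = 2 * alpha -> 0 < t1 -> 0 < B ->
  damped_moments alpha t1 f g W P Q ->
  (forall t, t1 < t -> 0 <= f t) -> (forall t, t1 < t -> gamma * f t <= g t) ->
  (forall t, t1 < t -> W t <= B * f t) ->
  exists C T, 0 < T /\ forall t, T <= t -> t `^ (lam * gamma) * f t <= C.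
Proof.
move=> g1 g2 lg2 lgE t10 B0 M f0 fg WB.
pose p := lam * gamma - 2.
have [p0 lam0 lpE l2p] : [/\ 0 < p, 0 < lam, lam + p / 2 = alpha - 1 &
    2 <= 2 * lam - p] by apply: lyapunov_exponents => //; lra.
have lp0 : 0 < lam * p by rewrite mulr_gt0.
have l2p0 : 0 < 2 * lam - p by lra.
pose c := lam * p / 4 * (2 * lam - p).
have c0 : 0 < c by rewrite /c !mulr_gt0.
pose D := 2 * c * B.
have D0 : 0 < D by rewrite /D !mulr_gt0.
pose E := energy lam (- (lam * p / 2)) f W P Q.
pose T := t1 + 1 + 2 * D + lam * p * B.
have lpB0 : 0 < lam * p * B by rewrite mulr_gt0.
have E_ge t : T <= t -> t ^+ 2 * f t <= 2 * E t.
  rewrite /T => Tt; have t1t : t1 < t by lra.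
  have [S _] := M t t1t; have := S lam t => {}S.
  have h1 : 0 <= lam * p * (B * f t - W t).
    by rewrite mulr_ge0 ?(ltW lp0)// subr_ge0 WB.
  have h2 : lam * p * B * f t <= t ^+ 2 * f t.
    rewrite ler_wpM2r ?f0// expr2.
    apply: (@le_trans _ _ (1 * t)); first lra.
    by rewrite ler_wpM2r//; lra.
  have h3 : 0 <= t ^+ 2 * f t by rewrite mulr_ge0 ?sqr_ge0// f0.
  by rewrite /E /energy; lra.
pose H t := t `^ p * E t.
have H_ge0 t : T <= t -> 0 <= H t.
  move=> Tt; rewrite /H mulr_ge0 ?powR_ge0//.
  have : 0 <= t ^+ 2 * f t by rewrite mulr_ge0 ?sqr_ge0// f0//; rewrite /T in Tt; lra.
  by have := E_ge t Tt; lra.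
have HG t : T <= t -> t `^ (lam * gamma) * f t <= 2 * (H t * (1 + t^-1)).
  move=> Tt; have t_gt0 : 0 < t by rewrite /T in Tt; lra.
  have -> : lam * gamma = p + 2 by rewrite /p; ring.
  rewrite powRD; last by rewrite (gt_eqF t_gt0) implybT.
  rewrite (powR_mulrn 2) ?(ltW t_gt0)// -mulrA.
  rewrite (le_trans (ler_wpM2l (powR_ge0 _ _) (E_ge t Tt)))//.
  rewrite mulrCA -/(H t) ler_wpM2l// ler_peMr ?H_ge0//.
  by rewrite lerDl invr_ge0 ltW.
pose dH t := t `^ (p - 1) *
  (t ^+ 2 * ((p + 2) * f t - lam * g t) + lam * p / 4 * (2 * lam - p) * W t).
exists (2 * (H T * (1 + T^-1))), T; split; first by rewrite /T; lra.
move=> t Tt; rewrite (le_trans (HG t Tt))// ler_wpM2l//.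
rewrite -lerN2; apply: (@is_derive_nondecreasing _
  (fun t => - (H t * (1 + t^-1)))
  (fun t => - (dH t * (1 + t^-1) - t ^- 2 * H t)) T) => // s Ts.
  have s_gt0 : 0 < s by rewrite /T in Ts; lra.
  have sn0 : s != 0 by rewrite gt_eqF.
  apply: is_deriveN.
  have HD : is_derive s 1 H (dH s).
    rewrite /dH -(energy_sharp _ _ g W P Q lpE).
    by apply: is_derive_powR_energy M; [lra | rewrite /T in Ts; lra].
  have ID := is_deriveV sn0 (is_derive_id s (1 : R)).
  have := is_deriveM HD (is_deriveD (is_derive_cst (1 : R) s (1 : R)) ID).
  move=> /is_derive_eq; apply.
  rewrite /GRing.scale /= !fctE add0r mulr1; ring.
have s_gt1 : 1 < s by rewrite /T in Ts; lra.
have s_gt0 : 0 < s by lra.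
have t1s : t1 < s by rewrite /T in Ts; lra.
have f_ge0 := f0 s t1s.
rewrite oppr_ge0 subr_le0.
have dH_le : dH s <= D * (s ^- 3 * H s).
  have -> : D * (s ^- 3 * H s) = s `^ (p - 1) * (D * s ^- 2 * E s).
    rewrite /H (powR_predE p s_gt0).
    by field; rewrite gt_eqF.
  rewrite /dH ler_wpM2l ?powR_ge0//.
  have h1 : 0 <= lam * s ^+ 2 * (g s - gamma * f s).
    apply: mulr_ge0; last by rewrite subr_ge0 fg.
    by rewrite mulr_ge0 ?sqr_ge0// ltW.
  have h2 : c * W s <= c * (B * f s) by rewrite ler_wpM2l ?(ltW c0)// WB.
  (* D = 2 c B: one factor B from W <= B f, a factor 2 from t^2 f <= 2 E *)
  have h3 : c * (B * f s) <= D * s ^- 2 * E s.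
    have -> : D * s ^- 2 * E s = c * (B * (s ^- 2 * (2 * E s))).
      by rewrite /D; ring.
    rewrite ler_pM2l// ler_pM2l// ler_pdivlMl ?exprn_gt0//; exact: E_ge.
  rewrite -/c.
  have h4 : (p + 2) * f s = lam * (gamma * f s) by rewrite /p; ring.
  by rewrite h4; move: h1 h2 h3; lra.
have s2 : 1 + s^-1 <= 2.
  have : s^-1 <= 1 by rewrite invf_le1 ?ltW.
  by lra.
(* since s >= 2 D, the right-hand side is at most s^-2 H *)
have : dH s * (1 + s^-1) <= D * (s ^- 3 * H s) * 2.
  apply: (@le_trans _ _ (D * (s ^- 3 * H s) * (1 + s^-1))).
    by rewrite ler_wpM2r// addr_ge0// invr_ge0 ltW.
  rewrite ler_wpM2l// mulr_ge0 ?(ltW D0)// mulr_ge0 ?H_ge0//.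
  by rewrite invr_ge0 exprn_ge0// ltW.
move=> /le_trans; apply.
have -> : D * (s ^- 3 * H s) * 2 = (2 * D) * s^-1 * (s ^- 2 * H s).
  by field; rewrite gt_eqF.
rewrite -[X in _ <= X]mul1r ler_wpM2r//.
  by rewrite mulr_ge0 ?H_ge0// invr_ge0 sqr_ge0.
by rewrite ler_pdivrMr// mul1r; rewrite /T in Ts; lra.
Qed.

(** At any time H(t) >= H(t1) > 0, so t^2 f and |lam x + t v|^2 cannot both be
    small.  If f were small for all large times, the second one would be large
    for all large times; but t^(lam - 1) (lam x + t v) is the derivative of
    t^lam x, which is bounded as long as t^(lam gamma) f is.  The mean value
    theorem applied over a long interval gives the contradiction, without any
    information on the oscillations of x. *)
Lemma lower_rate (R : realType) (alpha gamma lam t0 t1 : R) (x v : R -> R) :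
  1 < gamma -> gamma <= 2 -> 2 < lam * gamma ->
  lam * (gamma + 2) = 2 * alpha -> 0 <= t0 -> t0 < t1 ->
  (forall t, t0 < t -> is_derive t 1 x (v t)) ->
  let f := fun t => `|x t| `^ gamma in
  damped_moments alpha t0 f (fun t => gamma * f t) (fun t => x t ^+ 2)
    (fun t => x t * v t) (fun t => v t ^+ 2) ->
  0 < energy lam (- (lam * (lam * gamma - 2) / 2)) f (fun t => x t ^+ 2)
    (fun t => x t * v t) (fun t => v t ^+ 2) t1 ->
  exists2 K, 0 < K &
    forall T, exists2 t, T <= t & K * t `^ (- (lam * gamma)) <= f t.
Proof.
move=> g1 g2 lg2 lgE t00 t01 xD f M E0.
pose p := lam * gamma - 2.
have [p0 lam0 lpE l2p] : [/\ 0 < p, 0 < lam, lam + p / 2 = alpha - 1 &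
    2 <= 2 * lam - p] by apply: lyapunov_exponents => //; lra.
have lp0 : 0 < lam * p by rewrite mulr_gt0.
pose E := energy lam (- (lam * p / 2)) f (fun t => x t ^+ 2)
    (fun t => x t * v t) (fun t => v t ^+ 2).
pose H t := t `^ p * E t.
have H_nd t : t1 <= t -> H t1 <= H t.
  apply: (@is_derive_nondecreasing _ H (fun t => t `^ (p - 1) *
  (t ^+ 2 * ((p + 2) * f t - lam * (gamma * f t)) +
    lam * p / 4 * (2 * lam - p) * x t ^+ 2)) t1) => // s t1s.
    rewrite -(energy_sharp _ _ (fun t => gamma * f t) (fun t => x t ^+ 2)
      (fun t => x t * v t) (fun t => v t ^+ 2) lpE).
    by apply: is_derive_powR_energy M; lra.
  rewrite mulr_ge0 ?powR_ge0//.
  have -> : (p + 2) * f s = lam * (gamma * f s) by rewrite /p; ring.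
  by rewrite subrr mulr0 add0r mulr_ge0 ?sqr_ge0// mulr_ge0//; lra.
pose c := H t1.
have c0 : 0 < c by rewrite /c /H mulr_gt0// powR_gt0; lra.
exists (c / 2) => [|T]; first by rewrite divr_gt0.
apply: contrapT => /forall2NP fT.
pose T1 := Num.max (Num.max T t1) 1.
have f_lt t : T1 <= t -> t `^ (lam * gamma) * f t < c / 2.
  rewrite !ge_max => /andP[/andP[Tt _] t1t].
  have := fT t; rewrite Tt => -[//|/negP]; rewrite -ltNge powRN.
  have t_gt0 : 0 < t by lra.
  by rewrite -ltr_pdivlMl ?powR_gt0// mulrC.
pose y t := t `^ lam * x t.
pose dy t := t `^ (lam - 1) * (lam * x t + t * v t).
have yD t : T1 <= t -> is_derive t 1 y (dy t).
  rewrite !ge_max => /andP[/andP[_ t1t] t_ge1].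
  have t_gt0 : 0 < t by lra.
  have := is_deriveM (is_derive1_powR lam t_gt0) (xD t (lt_le_trans t01 t1t)).
  move=> /is_derive_eq; apply.
  rewrite /GRing.scale/= /dy.
  by rewrite (powR_predE lam t_gt0); ring.
have dy_ge t : T1 <= t -> Num.sqrt c <= `|dy t|.
  move=> T1t; have := f_lt t T1t.
  move: T1t; rewrite !ge_max => /andP[/andP[_ t1t] t_ge1].
  have t_gt0 : 0 < t by lra.
  have := H_nd t t1t; rewrite -/c => Ht ft.
  rewrite -sqrtr_sqr ler_wsqrtr//.
  have -> : dy t ^+ 2 =
      t `^ (2 * lam - p - 2) * (t `^ p * (lam * x t + t * v t) ^+ 2).
    (* the exponent 2 (lam - 1) is split as (2 lam - p - 2) + p *)
    rewrite /dy exprMn mulrA; congr (_ * _).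
    rewrite -powR_mulrn ?powR_ge0// -powRrM -powRD.
      by congr powR; rewrite -[2%:R]/2; ring.
    by rewrite (gt_eqF t_gt0) implybT.
  apply: (@le_trans _ _ (1 * (t `^ p * (lam * x t + t * v t) ^+ 2))).
    rewrite mul1r.
    have tE : t `^ (lam * gamma) * f t = t `^ p * (t ^+ 2 * f t).
      rewrite mulrA -powR_mulrn ?ltW// -powRD ?subrK//.
      by rewrite (gt_eqF t_gt0) implybT.
    have : 0 <= t `^ p * (lam * p * x t ^+ 2).
      by rewrite mulr_ge0 ?powR_ge0// mulr_ge0 ?sqr_ge0// ltW.
    move: Ht ft; rewrite tE /H /E /energy.
    set tp := t `^ p; move: tp => tp; lra.
  rewrite ler_wpM2r//; first by rewrite mulr_ge0 ?powR_ge0 ?sqr_ge0.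
  by rewrite -[X in X <= _](powRr0 t) ler_powR//; lra.
have y_le t : T1 <= t -> `|y t| <= 1 + c.
  move=> T1t; have := f_lt t T1t.
  move: T1t; rewrite !ge_max => /andP[/andP[_ t1t] t_ge1].
  have -> : t `^ (lam * gamma) * f t = `|y t| `^ gamma.
    by rewrite /y normrM ger0_norm ?powR_ge0// powRM ?powR_ge0// powRrM.
  have [y1|y1] := leP `|y t| 1; first by lra.
  have : `|y t| `^ 1 <= `|y t| `^ gamma by rewrite ler_powR ?(ltW y1)// ltW.
  by rewrite powRr1//; lra.
have sc0 : 0 < Num.sqrt c by rewrite sqrtr_gt0.
(* a length over which a slope sqrt c exceeds the oscillation 2 (1 + c) *)
pose t := T1 + (2 * (1 + c) + 1) / Num.sqrt c.
have T1t : T1 <= t by rewrite lerDl divr_ge0 ?sqrtr_ge0//; lra.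
have [||s + yE] := @MVT_segment R y dy T1 t T1t.
- by move=> u; rewrite in_itv/= => /andP[su _]; apply: yD; lra.
- apply: derivable_within_continuous => u; rewrite in_itv/= => /andP[su _].
  by have /yD[] : T1 <= u by lra.
rewrite in_itv/= => /andP[sc _].
have : Num.sqrt c * (t - T1) <= `|y t - y T1|.
  rewrite yE normrM (ger0_norm (_ : 0 <= t - T1)) ?subr_ge0//.
  by rewrite ler_wpM2r ?subr_ge0// dy_ge.
rewrite /t addrC addKr -/t mulrC divfK ?gt_eqF// => /le_trans/(_ (ler_normB _ _)).
by have := y_le t T1t; have := y_le T1 (lexx _); lra.
Qed.

(** * Euclidean calculus along a trajectory and convexity *)

(** At an interior time the restriction to s >= t0 is invisible. *)
Lemma derivative_from_is_derive (R : realType) (V : normedModType R) (t0 t : R)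
    (f f' : R -> V) :
  derivative_from t0 f f' -> t0 < t -> is_derive t 1 f (f' t).
Proof.
move=> /(_ t) + t0t => /(_ (ltW t0t)) fD.
have cv : (fun h : R => h^-1 *: ((f \o shift t) (h *: (1 : R)) - f t)) @ 0^'
    --> f' t.
  apply/cvgrPdist_lt => e e0.
  have /cvgrPdist_lt/(_ e e0) := fD.
  rewrite near_withinE => -[d /= d0 fd].
  exists (Num.min d (t - t0)) => /=; first by rewrite lt_min d0 subr_gt0.
  move=> h /=; rewrite sub0r normrN lt_min => /andP[hd ht] h0.
  have := fd (h + t); rewrite /= addrK; rewrite /GRing.scale/= mulr1; apply.
  - by rewrite opprD addrCA subrr addr0 normrN.
  - by rewrite -subr_eq0 addrK.
  - by move: ht; rewrite ltr_norml; lra.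
by apply: DeriveDef; [exact: cvgP cv | exact: cvg_lim cv].
Qed.

Lemma dotvC (R : realType) (n : nat) (u v : 'rV[R]_n) : dotv u v = dotv v u.
Proof. by apply: eq_bigr => i _; rewrite mulrC. Qed.

Lemma dotvDl (R : realType) (n : nat) (u v w : 'rV[R]_n) :
  dotv (u + v) w = dotv u w + dotv v w.
Proof.
by rewrite /dotv -big_split/=; apply: eq_bigr => i _; rewrite mxE mulrDl.
Qed.

Lemma dotvZl (R : realType) (n : nat) (a : R) (u v : 'rV[R]_n) :
  dotv (a *: u) v = a * dotv u v.
Proof.
by rewrite /dotv mulr_sumr; apply: eq_bigr => i _; rewrite mxE mulrA.
Qed.

Lemma dotvDr (R : realType) (n : nat) (u v w : 'rV[R]_n) :
  dotv w (u + v) = dotv w u + dotv w v.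
Proof. by rewrite dotvC dotvDl dotvC (dotvC v). Qed.

Lemma dotvZr (R : realType) (n : nat) (a : R) (u v : 'rV[R]_n) :
  dotv u (a *: v) = a * dotv u v.
Proof. by rewrite dotvC dotvZl dotvC. Qed.

Lemma dotv_ge0 (R : realType) (n : nat) (u : 'rV[R]_n) : 0 <= dotv u u.
Proof. by apply: sumr_ge0 => i _; rewrite -expr2 sqr_ge0. Qed.

Lemma dotv_combo_ge0 (R : realType) (n : nat) (u v : 'rV[R]_n) (a b : R) :
  0 <= a ^+ 2 * dotv u u + 2 * a * b * dotv u v + b ^+ 2 * dotv v v.
Proof.
have := dotv_ge0 (a *: u + b *: v).
rewrite !(dotvDl, dotvDr, dotvZl, dotvZr) (dotvC v u); lra.
Qed.

Lemma enormZ (R : realType) (n : nat) (a : R) (u : 'rV[R]_n) :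
  enorm (a *: u) = `|a| * enorm u.
Proof.
by rewrite /enorm dotvZl dotvZr mulrA -expr2 sqrtrM ?sqr_ge0// sqrtr_sqr.
Qed.

Lemma enorm_sqr (R : realType) (n : nat) (u : 'rV[R]_n) :
  enorm u ^+ 2 = dotv u u.
Proof. by rewrite /enorm sqr_sqrtr ?dotv_ge0. Qed.

Lemma is_derive_dotv (R : realType) (n : nat) (t : R) (x y : R -> 'rV[R]_n)
    (dx dy : 'rV[R]_n) :
  is_derive t 1 x dx -> is_derive t 1 y dy ->
  is_derive t 1 (fun s => dotv (x s) (y s)) (dotv dx (y t) + dotv (x t) dy).
Proof.
have coordD (z : R -> 'rV[R]_n) dz i :
    is_derive t 1 z dz -> is_derive t 1 (fun s => z s 0 i) (dz 0 i).
  move=> [zD <-]; apply: DeriveDef; first by have /derivable_mxP := zD; apply.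
  by rewrite derive_mx// mxE.
move=> xD yD.
have -> : (fun s => dotv (x s) (y s)) =
    \sum_(i < n) (fun s => x s 0 i) * (fun s => y s 0 i).
  by apply/funext => s; rewrite fct_sumE.
have := is_derive_sum
  (fun i => is_deriveM (coordD _ _ i xD) (coordD _ _ i yD)).
move=> /is_derive_eq; apply.
rewrite /dotv -big_split/=; apply: eq_bigr => i _.
by rewrite /GRing.scale/=; ring.
Qed.

Lemma diff_grad (R : realType) (n : nat) (F : 'rV[R]_n -> R)
    (z u : 'rV[R]_n) :
  differentiable F z -> 'd F z u = dotv (grad F z) u.
Proof.
move=> Fz; rewrite {1}(row_sum_delta u) linear_sum.
apply: eq_bigr => i _; rewrite linearZ/= mxE deriveE//; exact: mulrC.
Qed.

Lemma is_derive_comp_grad (R : realType) (n : nat) (F : 'rV[R]_n -> R) (t : R)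
    (x : R -> 'rV[R]_n) (dx : 'rV[R]_n) :
  differentiable F (x t) -> is_derive t 1 x dx ->
  is_derive t 1 (F \o x) (dotv (grad F (x t)) dx).
Proof.
move=> Fx [xD <-].
have xd : differentiable x t by exact/derivable1_diffP.
have Fxd : differentiable (F \o x) t by exact: differentiable_comp.
apply: DeriveDef; first exact/derivable1_diffP.
by rewrite deriveE// diff_comp//= diff_grad// -deriveE.
Qed.

Lemma convex_segment (R : realType) (n : nat) (F : 'rV[R]_n -> R)
    (x y : 'rV[R]_n) (s : R) :
  convex_function [set: 'rV[R]_n] F -> 0 <= s -> s <= 1 ->
  F (x + s *: (y - x)) <= F x + s * (F y - F x).
Proof.
move=> Fc s0 s1.
have := Fc (Itv01 s0 s1) y x (mem_setT _) (mem_setT _).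
rewrite convRE/= /unstable.onem => cF.
have -> : x + s *: (y - x) = s *: y + (1 - s) *: x.
  by rewrite scalerBr scalerBl scale1r addrCA.
by apply: le_trans cF _; lra.
Qed.

(** The slope of F along the segment from x to y is at most F y - F x. *)
Lemma convex_gradient_ineq (R : realType) (n : nat) (F : 'rV[R]_n -> R)
    (x y : 'rV[R]_n) :
  convex_function [set: 'rV[R]_n] F -> differentiable F x ->
  F x - F y <= dotv (grad F x) (x - y).
Proof.
move=> Fc Fx; have -> : x - y = -1 *: (y - x) by rewrite scaleN1r opprB.
rewrite dotvZr mulN1r -diff_grad//.
rewrite -deriveE// -lerN2 opprK opprB.
have /cvgrPdist_lt cv : derivable F x (y - x) by exact: diff_derivable.
apply/ler_addgt0Pr => e e0.
have [d /= d0 Hd] := cv e e0.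
pose h := Num.min (d / 2) 1.
have h0 : 0 < h by rewrite lt_min divr_gt0//=.
have h1 : h <= 1 by rewrite ge_min lexx orbT.
have hd : h < d by rewrite gt_min; apply/orP; left; lra.
have := Hd h; rewrite /= sub0r normrN gtr0_norm// => /(_ hd).
rewrite gt_eqF// => /(_ isT) D.
have := convex_segment x y Fc (ltW h0) h1; rewrite addrC => C.
have : h^-1 *: (F (h *: (y - x) + x) - F x) <= F y - F x.
  by rewrite /GRing.scale/= ler_pdivrMl//; lra.
by move: D; rewrite ltr_norml /derive; lra.
Qed.

Lemma edistance_set1 (R : realType) (n : nat) (x y : 'rV[R]_n) :
  edistance x [set y] = enorm (x - y).
Proof. by rewrite /edistance image_set1 inf1. Qed.

Lemma minval_argmin (R : realType) (T : Type) (F : T -> R) (x : T) :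
  argmin F x -> minval F = F x.
Proof.
move=> xF; apply/eqP; rewrite eq_le; apply/andP; split.
  by apply: ge_inf; [exists (F x) => _ [y _ <-]; exact: xF | exists x].
by apply: lb_le_inf; [exists (F x), x | move=> _ [y _ <-]; exact: xF].
Qed.

(** A point outside the sphere projects radially to a point of the sphere, where
    convexity makes the excess of F no larger.  This replaces coercivity and
    compactness arguments. *)
Lemma small_value_near_argmin (R : realType) (n : nat) (F : 'rV[R]_n -> R)
    (xs : 'rV[R]_n) (r m : R) :
  convex_function [set: 'rV[R]_n] F -> argmin F xs -> 0 < r ->
  (forall y, enorm (y - xs) = r -> m <= F y - F xs) ->
  forall x, F x - F xs < m -> enorm (x - xs) < r.
Proof.
move=> Fc xsF r0 Fm x; apply: contraTT; rewrite -!leNgt => rx.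
have e0 : 0 < enorm (x - xs) by lra.
pose s := r / enorm (x - xs).
have s0 : 0 <= s by rewrite divr_ge0// ltW.
have s1 : s <= 1 by rewrite ler_pdivrMr// mul1r.
have := convex_segment xs x Fc s0 s1.
have : m <= F (xs + s *: (x - xs)) - F xs.
  by apply: Fm; rewrite addrC addKr enormZ ger0_norm// divfK// gt_eqF.
have := xsF x.
have : 0 <= (1 - s) * (F x - F xs) by rewrite mulr_ge0// subr_ge0//; exact: xsF.
lra.
Qed.

(** * The upper bound *)

(** The equation is only used through these identities; the derivative of P and
    of Q come from replacing the acceleration by - (alpha / t) v - grad F(x). *)
Lemma damped_moments_solution (R : realType) (n : nat) (F : 'rV[R]_n -> R)
    (alpha t0 : R) (x v : R -> 'rV[R]_n) (xs : 'rV[R]_n) :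
  (forall z, differentiable F z) -> is_solution (grad F) alpha t0 x v ->
  damped_moments alpha t0 (fun t => F (x t) - F xs)
    (fun t => dotv (grad F (x t)) (x t - xs))
    (fun t => dotv (x t - xs) (x t - xs)) (fun t => dotv (x t - xs) (v t))
    (fun t => dotv (v t) (v t)).
Proof.
move=> Fd [xD [a vD ode]] t t0t; split; first by move=> *; exact: dotv_combo_ge0.
have {}xD := derivative_from_is_derive xD t0t.
have {}vD := derivative_from_is_derive vD t0t.
have wD : is_derive t 1 (fun s => x s - xs) (v t).
  have := is_deriveB xD (is_derive_cst xs t (1 : R)).
  by move=> /is_derive_eq; apply; rewrite subr0.
have aE : a t = - (alpha / t) *: v t + (-1) *: grad F (x t).
  have := ode t (ltW t0t); move/eqP; rewrite addr_eq0 => /eqP e.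
  by rewrite scaleN1r -e scaleNr addrC addrK.
exists (dotv (grad F (x t)) (v t)); split.
- have := is_deriveB (is_derive_comp_grad (Fd (x t)) xD)
    (is_derive_cst (F xs) t (1 : R)).
  by move=> /is_derive_eq; apply; rewrite subr0.
- have := is_derive_dotv wD wD; move=> /is_derive_eq; apply.
  by rewrite (dotvC (v t)); ring.
- have := is_derive_dotv wD vD; move=> /is_derive_eq; apply.
  rewrite aE; move: (x t - xs) => w.
  by rewrite dotvDr !dotvZr (dotvC _ (grad F (x t))); ring.
- have := is_derive_dotv vD vD; move=> /is_derive_eq; apply.
  by rewrite aE !(dotvDr, dotvDl, dotvZr, dotvZl) (dotvC (v t) (grad F (x t))); ring.
Qed.

(** The distance to the minimizer is not known to be small a priori: the crude
    decay of the potential brings the trajectory into the ball where the two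
    local hypotheses hold, and from then on the sharp estimate applies. *)
Lemma decay_rate (R : realType) (n : nat) (F : 'rV[R]_n -> R)
    (gamma alpha t0 : R) (x v : R -> 'rV[R]_n) (xs : 'rV[R]_n) :
  convex_function [set: 'rV[R]_n] F -> (forall z, differentiable F z) ->
  argmin F = [set xs] -> 1 <= gamma -> gamma <= 2 -> 0 < t0 ->
  1 + 2 / gamma < alpha -> is_solution (grad F) alpha t0 x v ->
  H1 F gamma -> H2 F 2 ->
  exists C T, 0 < T /\ forall t, T <= t ->
    t `^ (2 * gamma * alpha / (gamma + 2)) * (F (x t) - minval F) <= C.
Proof.
move=> Fc Fd argF g1 g2 t00 alphag sol FH1 FH2.
have xsF : argmin F xs by rewrite argF.
rewrite (minval_argmin xsF).
have M := damped_moments_solution xs Fd sol.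
have g0 : 0 < gamma by lra.
have alpha2 : 2 <= alpha.
  have : 1 <= 2 / gamma by rewrite ler_pdivlMr// mul1r.
  lra.
have f0 t : 0 <= F (x t) - F xs by rewrite subr_ge0; exact: xsF.
have [||C fC] := potential_decay alpha2 t00 M => //.
  by move=> t _; exact: convex_gradient_ineq.
have [eta eta0 FH1'] := FH1 xs xsF.
have [K [eps [K0 eps0 FH2']]] := FH2 xs xsF.
pose r := Num.min eta eps / 2.
have r0 : 0 < r by rewrite divr_gt0// lt_min eta0.
have r_eta : r < eta.
  have : Num.min eta eps <= eta by rewrite ge_min lexx.
  by rewrite /r; lra.
have r_eps : r < eps.
  have : Num.min eta eps <= eps by rewrite ge_min lexx orbT.
  by rewrite /r; lra.
have grow y : enorm (y - xs) < eps -> K * dotv (y - xs) (y - xs) <= F y - F xs.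
  move=> ye; have := FH2' y ye.
  rewrite argF edistance_set1 (minval_argmin xsF) (powR_mulrn 2) ?sqrtr_ge0//.
  by rewrite enorm_sqr.
have near_xs : forall y, F y - F xs < K * r ^+ 2 -> enorm (y - xs) < r.
  apply: small_value_near_argmin => // y yr.
  by rewrite -yr enorm_sqr; apply: grow; rewrite yr.
have Kr0 : 0 < K * r ^+ 2 by rewrite mulr_gt0// exprn_gt0.
pose t1 := Num.max (t0 + 1) (C / (K * r ^+ 2)).
have close t : t1 < t -> enorm (x t - xs) < r.
  rewrite gt_max => /andP[t0t Ct]; apply: near_xs.
  apply: (le_lt_trans (fC t (ltW t0t))).
  by rewrite ltr_pdivrMr; [rewrite mulrC -ltr_pdivrMr|lra].
have t01 : t0 < t1 by rewrite lt_max; apply/orP; left; lra.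
have [lam [lamE -> lg2]] := rate_exponent g0 alphag.
have [||||||C' [T [T0 rate]]] := @upper_rate _ alpha gamma lam t1 K^-1
    (fun t => F (x t) - F xs) (fun t => dotv (grad F (x t)) (x t - xs))
    (fun t => dotv (x t - xs) (x t - xs)) (fun t => dotv (x t - xs) (v t))
    (fun t => dotv (v t) (v t)) g1 g2 lg2 lamE.
- lra.
- by rewrite invr_gt0.
- by move=> t t1t; apply: M; lra.
- by move=> t _; exact: f0.
- move=> t t1t; rewrite -ler_pdivlMl//.
  have := FH1' (x t); rewrite (minval_argmin xsF); apply.
  by rewrite /eball/=; have := close t t1t; lra.
- move=> t t1t; rewrite ler_pdivlMl//; apply: grow.
  by have := close t t1t; lra.
by exists C', T.
Qed.

Lemma eqO_decay (R : realType) (f : R -> R) (q C T : R) :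
  0 < T -> (forall t, 0 <= f t) -> (forall t, T <= t -> t `^ q * f t <= C) ->
  (f : R -> R^o) =O_ (pinfty_nbhs R) (fun t : R => 1 / t `^ q : R^o).
Proof.
move=> T0 f0 fC; apply/eqO_exP; exists (`|C| + 1); first by rewrite ltr_wpDl.
near=> t.
have Tt : T <= t by near: t; exact: nbhs_pinfty_ge (num_real _).
have tq : 0 < t `^ q by rewrite powR_gt0; lra.
rewrite (ger0_norm (f0 t)) (@ger0_norm _ (1 / _)) ?divr_ge0 ?powR_ge0//.
rewrite mulrA mulr1 ler_pdivlMr// mulrC (le_trans (fC t Tt))//.
by rewrite (le_trans (ler_norm C))// lerDl.
Unshelve. all: by end_near. Qed.


(** * Global existence by Euler approximations *)

Fixpoint euler (R : realType) (V : normedModType R) (A : R -> V -> V)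
    (t0 h : R) (u0 : V) (j : nat) : V :=
  if j is i.+1 then
    let u := euler A t0 h u0 i in u + h *: A (t0 + i%:R * h) u
  else u0.

(** Discrete Gronwall: each step multiplies 1 + |u| by at most
    1 + L h <= exp(L h). *)
Lemma euler_growth (R : realType) (V : normedModType R) (A : R -> V -> V)
    (t0 h L : R) (u0 : V) (j : nat) :
  0 <= h -> 0 <= L ->
  (forall t u, t0 <= t -> `|A t u| <= L * (1 + `|u|)) ->
  1 + `|euler A t0 h u0 j| <= (1 + `|u0|) * expR (L * (j%:R * h)).
Proof.
move=> h0 L0 AL; elim: j => [|j IH] /=; first by rewrite mul0r mulr0 expR0 mulr1.
set u := euler A t0 h u0 j in IH *.
have tj : t0 <= t0 + j%:R * h by rewrite lerDl mulr_ge0.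
apply: (@le_trans _ _ ((1 + `|u|) * (1 + L * h))).
  rewrite mulrDr mulr1 -addrA lerD2l (le_trans (ler_normD _ _))// lerD2l.
  have -> : (1 + `|u|) * (L * h) = h * (L * (1 + `|u|)) by ring.
  by rewrite normrZ ger0_norm// ler_wpM2l// AL.
have -> : L * (j.+1%:R * h) = L * (j%:R * h) + L * h by rewrite -natr1; ring.
rewrite expRD [leRHS]mulrA.
have Lh1 : 1 + L * h <= expR (L * h) by exact: expR_ge1Dx.
by apply: ler_pM IH Lh1; rewrite addr_ge0// mulr_ge0.
Qed.

(** Stated for p and q in any order because the derivative is two-sided: the
    approximation is compared with its value at a later time as well as at an
    earlier one.  With a = 0 this is a Lipschitz estimate. *)
Lemma euler_increment (R : realType) (V : normedModType R) (A : R -> V -> V)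
    (t0 h e : R) (u0 a : V) (p q : nat) :
  0 <= h ->
  (forall l, (minn p q <= l < maxn p q)%N ->
    `|A (t0 + l%:R * h) (euler A t0 h u0 l) - a| <= e) ->
  `|euler A t0 h u0 q - euler A t0 h u0 p - ((q%:R - p%:R) * h) *: a|
    <= `|q%:R - p%:R| * h * e.
Proof.
move=> h0; wlog pq : p q / (p <= q)%N => [wl Ae|].
  have [pq|qp] := leqP p q; first exact: wl.
  set U := euler A t0 h u0 in wl *.
  have -> : U q - U p - ((q%:R - p%:R) * h) *: a =
      - (U p - U q - ((p%:R - q%:R) * h) *: a).
    by rewrite !opprB -(opprB p%:R q%:R) mulNr scaleNr opprK addrC.
  rewrite normrN (distrC q%:R).
  by apply: wl; [exact: ltnW|rewrite minnC maxnC].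
rewrite (minn_idPl pq) (maxn_idPr pq).
rewrite -(subnKC pq); elim: (q - p)%N => [|m IH] Ae.
  by rewrite addn0 !subrr mul0r scale0r subr0 !normr0 !mul0r.
rewrite addnS /= -natr1.
set U := euler A t0 h u0 in IH Ae *.
have -> : U (p + m)%N + h *: A (t0 + (p + m)%:R * h) (U (p + m)%N) - U p -
    (((p + m)%:R + 1 - p%:R) * h) *: a =
    (U (p + m)%N - U p - (((p + m)%:R - p%:R) * h) *: a) +
    h *: (A (t0 + (p + m)%:R * h) (U (p + m)%N) - a).
  have -> : ((p + m)%:R + 1 - p%:R) * h = ((p + m)%:R - p%:R) * h + h by ring.
  by rewrite scalerDl scalerBr [X in X - _]addrAC opprD addrACA.
rewrite (le_trans (ler_normD _ _))//.
have -> : `|(p + m)%:R + 1 - p%:R : R| = `|(p + m)%:R - p%:R| + 1.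
  have -> : (p + m)%:R + 1 - p%:R = m%:R + 1 :> R by rewrite natrD; ring.
  have -> : (p + m)%:R - p%:R = m%:R :> R by rewrite natrD; ring.
  by rewrite !ger0_norm// addr_ge0.
have -> : (`|(p + m)%:R - p%:R| + 1) * h * e =
    `|(p + m)%:R - p%:R| * h * e + h * e by ring.
rewrite lerD//.
  by apply: IH => l /andP[pl lm]; apply: Ae; rewrite pl/= addnS ltnW.
rewrite normrZ ger0_norm// ler_wpM2l//.
by apply: Ae; rewrite leq_addr/= addnS ltnSn.
Qed.

Lemma truncn_grid (R : realType) (t0 h t : R) :
  0 < h -> t0 <= t ->
  t0 + (Num.truncn ((t - t0) / h))%:R * h <= t <
    t0 + (Num.truncn ((t - t0) / h))%:R * h + h.
Proof.
move=> h0 t0t; have : 0 <= (t - t0) / h by rewrite divr_ge0 ?subr_ge0// ltW.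
move=> /truncn_itv; set n := Num.truncn _.
rewrite ler_pdivlMr// ltr_pdivrMr// -natr1 mulrDl mul1r.
by move=> /andP[? ?]; apply/andP; split; lra.
Qed.

(** Consistency of the step function u at the time t: all the nodes visited
    between t and s stay close to (t, z), by the Lipschitz bound, so the field
    is nearly a there.  The times t and s are only known up to h, whence the
    two terms in h, which vanish in the limit.  Only closeness of u t to z is
    assumed, which is what pointwise convergence provides. *)
Lemma euler_local (R : realType) (V : normedModType R) (A : R -> V -> V)
    (t0 h M d e t s : R) (u0 z a : V) :
  let u r := euler A t0 h u0 (Num.truncn ((r - t0) / h)) in
  0 < h -> 0 <= M -> t0 <= t -> t0 <= s ->
  (forall j, t0 + j%:R * h <= Num.max t s ->
    `|A (t0 + j%:R * h) (euler A t0 h u0 j)| <= M) ->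
  (forall r w, t0 <= r -> `|r - t| < d -> `|w - z| < d -> `|A r w - a| <= e) ->
  `|u t - z| < d / 2 -> (`|s - t| + h) * (M + 1) < d / 2 ->
  `|u s - u t - (s - t) *: a| <= (`|s - t| + h) * e + h * `|a|.
Proof.
move=> u h0 M0 t0t t0s AM Ae utz std.
have d0 : 0 < d.
  by have := normr_ge0 (u t - z); lra.
have /andP[ti it] := truncn_grid h0 t0t; have /andP[sj js] := truncn_grid h0 t0s.
rewrite {}/u in utz *.
set i := Num.truncn _ in ti it utz *; set j := Num.truncn _ in sj js *.
have e0 : 0 <= e.
  rewrite (le_trans (normr_ge0 (A t z - a)))// Ae// subrr normr0//.
have ij_h : `|j%:R - i%:R| * h <= `|s - t| + h.
  rewrite -[X in _ * X](gtr0_norm h0) -normrM mulrBl.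
  rewrite ler_norml; apply/andP; split.
    by have := ler_norm (t - s); rewrite distrC; lra.
  by have := ler_norm (s - t); lra.
have sth : `|s - t| + h < d / 2.
  apply: le_lt_trans std; rewrite mulrDr mulr1 lerDr mulr_ge0// addr_ge0//.
  exact: ltW.
have between l : (minn i j <= l <= maxn i j)%N ->
    `|l%:R - i%:R| <= `|j%:R - i%:R| :> R.
  have [ij|ji] := leqP i j => /andP[].
    rewrite -2![(_ <= _)%N](ler_nat R) => il lj.
    by rewrite !ger0_norm//; lra.
  rewrite -2![(_ <= _)%N](ler_nat R) => il lj.
  by rewrite !ler0_norm//; lra.
have grid_le l : (l <= maxn i j)%N -> t0 + l%:R * h <= Num.max t s.
  rewrite leq_max le_max => /orP[li|lj]; apply/orP; [left|right].
    by apply: le_trans ti; rewrite lerD2l ler_wpM2r ?(ltW h0)// ler_nat.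
  by apply: le_trans sj; rewrite lerD2l ler_wpM2r ?(ltW h0)// ler_nat.
have drift l : (minn i j <= l <= maxn i j)%N ->
    `|euler A t0 h u0 l - euler A t0 h u0 i| <= (`|s - t| + h) * M.
  move=> lij; have lj := between l lij.
  have inc := @euler_increment _ _ A t0 h M u0 0 i l (ltW h0).
  rewrite scaler0 subr0 in inc; apply: le_trans (inc _) _.
    move=> m /andP[_ ml]; rewrite subr0 AM// grid_le//.
    rewrite (leq_trans (ltnW ml))// geq_max leq_maxl/=.
    by case/andP: lij.
  by rewrite ler_wpM2r// (le_trans _ ij_h)// ler_wpM2r// ltW.
have incr : `|euler A t0 h u0 j - euler A t0 h u0 i - ((j%:R - i%:R) * h) *: a|
    <= `|j%:R - i%:R| * h * e.
  apply: euler_increment; first exact: ltW.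
  move=> l /andP[il lj].
  have lij : (minn i j <= l <= maxn i j)%N by rewrite il ltnW.
  have lh : `|l%:R - i%:R| * h <= `|s - t| + h.
    by rewrite (le_trans _ ij_h)// ler_wpM2r ?(ltW h0)// between.
  apply: Ae.
  - by rewrite lerDl mulr_ge0// ltW.
  - have : `|(l%:R - i%:R) * h| <= `|s - t| + h.
      by rewrite normrM (gtr0_norm h0).
    rewrite ler_norml mulrBl => /andP[l1 l2].
    have st0 := normr_ge0 (s - t).
    by rewrite ltr_norml; apply/andP; split; lra.
  - rewrite -(subrKA (euler A t0 h u0 i)) (le_lt_trans (ler_normD _ _))//.
    have := drift l lij.
    have : (`|s - t| + h) * M <= (`|s - t| + h) * (M + 1).
      by rewrite ler_wpM2l ?lerDl// addr_ge0// ltW.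
    lra.
have jih : `|(j%:R - i%:R) * h - (s - t)| <= h.
  by rewrite mulrBl ler_norml; apply/andP; split; lra.
have -> : euler A t0 h u0 j - euler A t0 h u0 i - (s - t) *: a =
  (euler A t0 h u0 j - euler A t0 h u0 i - ((j%:R - i%:R) * h) *: a) +
  ((j%:R - i%:R) * h - (s - t)) *: a.
  by rewrite [X in _ = _ + X]scalerBl subrKA.
rewrite (le_trans (ler_normD _ _))// lerD//.
  by rewrite (le_trans incr)// ler_wpM2r.
by rewrite normrZ ler_wpM2r.
Qed.

Lemma ultra_fmap (T U : Type) (f : T -> U) (F : set_system T) :
  UltraFilter F -> UltraFilter (f @ F).
Proof.
move=> FU; split; first exact: fmap_proper_filter.
move=> G GP FG; apply/seteqP; split; last exact: FG.
move=> B GB; have [//|FnB] := in_ultra_setVsetC (f @^-1` B) FU.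
have GnB : G (~` B) by apply: FG.
have := @filterI _ G _ _ _ GB GnB; rewrite setICr => G0.
by case: (filter_not_empty G (G0 _)).
Qed.

(** Along an ultrafilter finer than the filter at infinity, every bounded
    family of Euler values converges, at all times simultaneously; this stands
    for the extraction of a uniformly convergent subsequence.  Passing to the
    limit in [euler_local] yields |u s - u t - (s - t) a| <= |s - t| e for s
    near t, which is differentiability at t. *)
Lemma peano_global (R : realType) (V : normedModType R) (A : R -> V -> V)
    (t0 L : R) (u0 : V) :
  (forall M, compact [set u : V | `|u| <= M]) ->
  (forall t u, t0 <= t -> {for (t, u), continuous (fun p => A p.1 p.2)}) ->
  0 <= L -> (forall t u, t0 <= t -> `|A t u| <= L * (1 + `|u|)) ->
  exists u : R -> V, u t0 = u0 /\ derivative_from t0 u (fun t => A t (u t)).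
Proof.
move=> cptV Ac L0 AL.
have [F [FU Foo]] := ultraFilterLemma (eventually_filter : ProperFilter \oo).
pose h (k : nat) : R := k.+1%:R^-1.
have h0 k : 0 < h k by rewrite invr_gt0.
have hF : h @ F --> (0 : R).
  apply: cvg_trans (@cvg_harmonic R).
  by move=> B /Foo.
pose uk k t := euler A t0 (h k) u0 (Num.truncn ((t - t0) / h k)).
pose bd t := (1 + `|u0|) * expR (L * (t - t0)).
have euler_bd k j t : t0 + j%:R * h k <= t -> 1 + `|euler A t0 (h k) u0 j| <= bd t.
  move=> jt; apply: (le_trans (euler_growth _ _ (ltW (h0 k)) L0 AL)).
  rewrite ler_wpM2l ?addr_ge0// ler_expR ler_wpM2l//; lra.
have /choice[u uP] : forall t, exists z : V, t0 <= t -> (uk ^~ t) @ F --> z.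
  move=> t; have [t0t|tt0] := leP t0 t; last by exists 0.
  have := cptV (bd t); rewrite compact_ultra => /(_ (uk ^~ t @ F)).
  case=> [||z [_ zP]]; last by exists z.
    exact: ultra_fmap.
  suff : F [set k | `|uk k t| <= bd t] by [].
  apply: filterS filterT => k _ /=.
  have /andP[kt _] := truncn_grid (h0 k) t0t.
  by have := euler_bd k _ _ kt; rewrite -/(uk k t); lra.
exists u; split.
  have := uP t0 (lexx _).
  have -> : uk ^~ t0 = fun=> u0.
    by apply/funext => k; rewrite /uk subrr mul0r truncn0.
  by move=> /cvg_lim <-//; rewrite lim_cst.
move=> t t0t; apply/cvgrPdist_le => e e0; rewrite near_withinE.
set a := A t (u t).
have [d /= d0 Ad] : exists2 d : R, 0 < d & forall r w,
    `|r - t| < d -> `|w - u t| < d -> `|A r w - a| <= e.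
  have /cvgrPdist_le/(_ e e0) := Ac t (u t) t0t.
  move=> /nbhs_ballP[d /= d0 Ad]; exists d => // r w rt wt.
  rewrite distrC; apply: (Ad (r, w)); split => /=.
    by rewrite /ball/= distrC.
  by rewrite -ball_normE/= distrC.
pose M := L * bd (t + 1).
have M0 : 0 <= M by rewrite mulr_ge0// mulr_ge0 ?expR_ge0// addr_ge0.
have AM k j : t0 + j%:R * h k <= t + 1 ->
    `|A (t0 + j%:R * h k) (euler A t0 (h k) u0 j)| <= M.
  move=> jt; rewrite (le_trans (AL _ _ _))//.
    by rewrite lerDl mulr_ge0// ltW.
  by rewrite ler_wpM2l// euler_bd.
exists (Num.min 1 (d / (4 * (M + 1)))) => /=.
  by rewrite lt_min ltr01 divr_gt0// mulr_gt0//; lra.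
move=> s /=; rewrite lt_min distrC => /andP[st1 std] st t0s.
have key : `|u s - u t - (s - t) *: a| <= `|s - t| * e.
  have lhs : (fun k => `|uk k s - uk k t - (s - t) *: a|) @ F -->
      `|u s - u t - (s - t) *: a|.
    apply: cvg_norm; apply: cvgB; last exact: cvg_cst.
    by apply: cvgB; apply: uP.
  have rhs : (fun k => (`|s - t| + h k) * e + h k * `|a|) @ F -->
      `|s - t| * e.
    have -> : `|s - t| * e = (`|s - t| + 0) * e + 0 * `|a|.
      by rewrite addr0 mul0r addr0.
    apply: cvgD; apply: cvgMl => //.
    by apply: cvgD => //; exact: cvg_cst.
  apply: (ler_cvg_to lhs rhs).
  have near_t : \forall k \near F, `|uk k t - u t| < d / 2.
    have /cvgrPdist_lt/(_ (d / 2)) := uP t t0t.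
    rewrite divr_gt0// => /(_ isT); apply: filterS => k.
    by rewrite distrC.
  have near_h : \forall k \near F, h k < d / (4 * (M + 1)).
    have /cvgrPdist_lt/(_ (d / (4 * (M + 1)))) := hF.
    rewrite divr_gt0// ?mulr_gt0//; last lra.
    move=> /(_ isT); apply: filterS => k.
    by rewrite sub0r normrN gtr0_norm.
  near=> k.
  apply: (@euler_local _ _ A t0 (h k) M d e t s u0 (u t) a) => //.
  - move=> j js; apply: AM; rewrite (le_trans js)// ge_max lerDl ler01/=.
    by have := ler_norm (s - t); lra.
  - by move=> r w _; exact: Ad.
  - by near: k.
  - rewrite -ltr_pdivlMr; last lra.
    have : h k < d / (4 * (M + 1)) by near: k.
    have -> : d / 2 / (M + 1) = d / (4 * (M + 1)) + d / (4 * (M + 1)).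
      by field; rewrite gt_eqF//; lra.
    lra.
have st0 : 0 < `|s - t| by rewrite normr_gt0 subr_eq0.
rewrite distrC -(@ler_pM2l _ `|s - t|)// -normrZ scalerBr scalerA divff.
  by rewrite scale1r.
by rewrite subr_eq0.
Unshelve. all: by end_near. Qed.

Lemma derivative_from_comp_linear (R : realType) (V W : normedModType R)
    (t0 : R) (u u' : R -> V) (l : {linear V -> W}) :
  continuous l -> derivative_from t0 u u' ->
  derivative_from t0 (l \o u) (l \o u').
Proof.
move=> lc uD t t0t.
have -> : (fun s => (s - t)^-1 *: ((l \o u) s - (l \o u) t)) =
    l \o (fun s => (s - t)^-1 *: (u s - u t)).
  by apply/funext => s /=; rewrite linearZ/= (linearB l).
exact: (cvg_comp _ _ (uD t t0t) (lc (u' t))).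
Qed.

Lemma compact_prod_ball (R : realType) (M : R) :
  compact [set u : R * R | `|u| <= M].
Proof.
have -> : [set u : R * R | `|u| <= M] = `[- M, M]%classic `*` `[- M, M]%classic.
  apply/seteqP; split => -[x y] /=; rewrite prod_normE/= !in_itv/= -!ler_norml.
    by rewrite ge_max => /andP.
  by rewrite ge_max => -[-> ->].
by apply: compact_setX; exact: segment_compact.
Qed.

(** The equation as a first-order system in (position, velocity). *)
Lemma damped_solution_exists (R : realType) (G : R -> R)
    (alpha t0 L x0 v0 : R) :
  0 < t0 -> continuous G -> (forall y, `|G y| <= L * (1 + `|y|)) ->
  exists x v, [/\ is_solution G alpha t0 x v, x t0 = x0 & v t0 = v0].
Proof.
move=> t00 Gc GL.
have L0 : 0 <= L.
  by have := le_trans (normr_ge0 _) (GL 0); rewrite normr0 addr0 mulr1.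
pose A (t : R) (p : R * R) : R * R := (p.2, - (alpha / t * p.2 + G p.1)).
have [|||t u|u [u0 uD]] := @peano_global R (R * R)%type A t0
    (1 + `|alpha| / t0 + L) (x0, v0).
- exact: compact_prod_ball.
- move=> t p t0t.
  have ct : (fun q : R * (R * R) => q.1) @ nbhs (t, p) --> t by exact: cvg_fst.
  have c1 : (fun q : R * (R * R) => q.2.1) @ nbhs (t, p) --> p.1.
    exact: (cvg_comp (fun q : R * (R * R) => q.2) fst
      (@cvg_snd _ _ _ _ _) (@cvg_fst _ _ _ _ _)).
  have c2 : (fun q : R * (R * R) => q.2.2) @ nbhs (t, p) --> p.2.
    exact: (cvg_comp (fun q : R * (R * R) => q.2) snd
      (@cvg_snd _ _ _ _ _) (@cvg_snd _ _ _ _ _)).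
  have cA : (fun q : R * (R * R) => - (alpha / q.1 * q.2.2 + G q.2.1))
      @ nbhs (t, p) --> - (alpha / t * p.2 + G p.1).
    apply: cvgN; apply: cvgD; last exact: (cvg_comp _ G c1 (Gc p.1)).
    apply: cvgM c2; apply: cvgM; first exact: cvg_cst.
    by apply: cvgV ct; rewrite gt_eqF//; lra.
  exact: (cvg_pair c2 cA).
- by rewrite !addr_ge0// divr_ge0// ltW.
- move=> t0t; have t_gt0 : 0 < t by lra.
  rewrite [leLHS]prod_normE/= ge_max.
  have u1 : `|u.1| <= `|u| by rewrite [leRHS]prod_normE le_max lexx.
  have u2 : `|u.2| <= `|u| by rewrite [leRHS]prod_normE le_max lexx orbT.
  have aL : 0 <= `|alpha| / t0 by rewrite divr_ge0// ltW.
  have aU : 0 <= (`|alpha| / t0 + L) * (1 + `|u|).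
    by rewrite mulr_ge0 ?addr_ge0.
  apply/andP; split; first by lra.
  rewrite normrN (le_trans (ler_normD _ _))//.
  have h1 : `|alpha / t * u.2| <= `|alpha| / t0 * `|u|.
    rewrite normrM ler_pM// normrM ler_wpM2l// gtr0_norm ?invr_gt0//.
    by rewrite lef_pV2.
  have h2 : `|G u.1| <= L * (1 + `|u|).
    by rewrite (le_trans (GL _))// ler_wpM2l// lerD2l.
  have := normr_ge0 u; lra.
exists (fst \o u), (snd \o u); split; rewrite /= ?u0//; split.
  apply: (derivative_from_comp_linear (l := fst)) uD.
  by move=> p; exact: cvg_fst.
exists (fun t => - (alpha / t * (u t).2 + G (u t).1)).
  apply: (derivative_from_comp_linear (l := snd)) uD.
  by move=> p; exact: cvg_snd.
by move=> t t0t /=; rewrite /GRing.scale/= -addrA addNr.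
Qed.

(** * The potential |y|^gamma and the optimality of the rate *)

(** Up to the factor c + 1, the derivative of |y|^(c + 1). *)
Definition signed_powR (R : realType) (c y : R) : R := Num.sg y * `|y| `^ c.

Lemma powR_small (R : realType) (c e : R) :
  0 < c -> 0 < e ->
  exists2 d : R, 0 < d & forall y : R, `|y| < d -> `|y| `^ c < e.
Proof.
move=> c0 e0; exists (e `^ c^-1) => [|y yd]; first exact: powR_gt0.
have := gt0_ltr_powR c0 (normr_ge0 y) (powR_ge0 e c^-1) yd.
by rewrite -powRrM mulVf ?gt_eqF// powRr1// ltW.
Qed.

Lemma norm_signed_powR (R : realType) (c y : R) :
  0 < c -> `|signed_powR c y| = `|y| `^ c.
Proof.
move=> c0; rewrite /signed_powR normrM normr_sg ger0_norm ?powR_ge0//.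
by have [->|_] := eqVneq y 0; rewrite ?normr0 ?powR0 ?gt_eqF ?mulr0 ?mul1r.
Qed.

Lemma signed_powR_continuous (R : realType) (c : R) :
  0 < c -> continuous (@signed_powR R c).
Proof.
move=> c0.
have pos y : 0 < y -> {for y, continuous (@signed_powR R c)}.
  move=> y0; have cy : {for y, continuous (fun z : R => z `^ c)}.
    apply: differentiable_continuous; apply/derivable1_diffP.
    by have [] := is_derive1_powR c y0.
  have sE z : 0 < z -> signed_powR c z = z `^ c.
    by move=> z0; rewrite /signed_powR gtr0_sg// gtr0_norm// mul1r.
  rewrite /prop_for/continuous_at/= sE//; apply: cvg_trans cy; apply: near_eq_cvg.
  by near=> z; rewrite sE//; near: z; exact: lt_nbhsr.
move=> y; have [y0|y0|->] := ltgtP y 0; last 2 first.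
- exact: pos.
- rewrite /continuous_at [X in _ --> X](_ : _ = 0) ?/signed_powR ?sgr0 ?mul0r//.
  apply/cvgrPdist_lt => e e0; have [d d0 dP] := powR_small c0 e0.
  exists d => //= z; rewrite /= !sub0r !normrN norm_signed_powR//.
  exact: dP.
have -> : @signed_powR R c = fun z => - signed_powR c (- z).
  by apply/funext => z; rewrite /signed_powR sgrN normrN mulNr opprK.
apply: cvgN; apply: (@continuous_comp _ _ _ -%R (@signed_powR R c)).
  exact: opp_continuous.
by apply: pos; rewrite oppr_gt0.
Unshelve. all: by end_near. Qed.

(** At 0 the difference quotient has absolute value |h|^(gamma - 1), which tends
    to 0 because gamma > 1. *)
Lemma is_derive_norm_powR (R : realType) (gamma y : R) :
  1 < gamma ->
  is_derive y 1 (fun z => `|z| `^ gamma) (gamma * signed_powR (gamma - 1) y).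
Proof.
move=> g1; have [y0|y0|->] := ltgtP y 0; last 2 first.
- apply: (@near_eq_is_derive _ _ _ (fun z : R => z `^ gamma)).
    near=> z; have z0 : 0 < z by near: z; exact: lt_nbhsr.
    by rewrite gtr0_norm.
  have := is_derive1_powR gamma y0; move=> /is_derive_eq; apply.
  by rewrite /signed_powR gtr0_sg// gtr0_norm// mul1r.
- have c0 : 0 < gamma - 1 by lra.
  have cv : (fun h : R => h^-1 *: (((fun z : R => `|z| `^ gamma) \o shift (0 : R))
      (h *: (1 : R)) - `|0 : R| `^ gamma)) @ 0^' --> (0 : R).
    apply/cvgrPdist_lt => e e0; have [d d0 dP] := powR_small c0 e0.
    exists d => //= h /=; rewrite sub0r normrN => hd hn0.
    rewrite sub0r normrN addr0 normr0 powR0 ?gt_eqF ?subr0//; last lra.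
    rewrite /GRing.scale/= mulr1 normrM normfV (ger0_norm (powR_ge0 _ _)).
    rewrite powR_predE ?normr_gt0//.
    by rewrite mulKf ?normr_eq0//; exact: dP.
  have s0 : signed_powR (gamma - 1) (0 : R) = 0.
    by rewrite /signed_powR sgr0 mul0r.
  by rewrite s0 mulr0; apply: DeriveDef; [exact: cvgP cv | exact: cvg_lim cv].
have -> : (fun z : R => `|z| `^ gamma) =
    (fun z => `|z| `^ gamma) \o (fun z => - z).
  by apply/funext => z /=; rewrite normrN.
have Ny0 : 0 < - y by rewrite oppr_gt0.
have pD : is_derive (- y) 1 (fun z => `|z| `^ gamma) (gamma * (- y) `^ (gamma - 1)).
  apply: (@near_eq_is_derive _ _ _ (fun z : R => z `^ gamma)).
    near=> z; have z0 : 0 < z by near: z; exact: lt_nbhsr.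
    by rewrite gtr0_norm.
  exact: is_derive1_powR.
have := is_derive1_comp pD (is_deriveN (is_derive_id y (1 : R))).
move=> /is_derive_eq; apply.
by rewrite /signed_powR ltr0_sg// ltr0_norm//; ring.
Unshelve. all: by end_near. Qed.

Lemma derive1_norm_powR (R : realType) (gamma : R) :
  1 < gamma ->
  derive1 (fun z : R => `|z| `^ gamma) =
  fun y => gamma * signed_powR (gamma - 1) y.
Proof.
move=> g1; apply/funext => y; rewrite derive1E.
by have [_ ->] := is_derive_norm_powR y g1.
Qed.

(** Euler's identity for the homogeneous potential: it turns the inequality
    gamma f <= g of the upper bound into an equality. *)
Lemma mul_signed_powR (R : realType) (gamma y : R) :
  1 < gamma -> y * signed_powR (gamma - 1) y = `|y| `^ gamma.
Proof.
move=> g1; have [->|y0] := eqVneq y 0.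
  by rewrite mul0r normr0 powR0// gt_eqF//; lra.
rewrite /signed_powR mulrA [y * _]mulrC -normrEsg.
by rewrite [RHS]powR_predE ?normr_gt0.
Qed.

Lemma signed_powR_growth (R : realType) (c y : R) :
  0 < c -> c <= 1 -> `|signed_powR c y| <= 1 + `|y|.
Proof.
move=> c0 c1; rewrite norm_signed_powR//.
have [y1|y1] := leP `|y| 1.
  have : `|y| `^ c <= 1 `^ c by apply: ge0_ler_powR; rewrite ?nnegrE// ltW.
  by rewrite powR1 => /le_trans; apply; rewrite lerDl.
have : `|y| `^ c <= `|y| `^ 1 by rewrite ler_powR// ltW.
by rewrite powRr1// => /le_trans; apply; rewrite lerDr.
Qed.

Lemma damped_moments_norm_powR (R : realType) (gamma alpha t0 : R) (x v : R -> R) :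
  1 < gamma ->
  is_solution (derive1 (fun y : R => `|y| `^ gamma)) alpha t0 x v ->
  damped_moments alpha t0 (fun t => `|x t| `^ gamma) (fun t => gamma * `|x t| `^ gamma)
    (fun t => x t ^+ 2) (fun t => x t * v t) (fun t => v t ^+ 2).
Proof.
move=> g1 [xD [a vD]]; rewrite derive1_norm_powR// => ode t t0t.
split=> [b c|].
  have -> : b ^+ 2 * x t ^+ 2 + 2 * b * c * (x t * v t) + c ^+ 2 * v t ^+ 2 =
    (b * x t + c * v t) ^+ 2 by ring.
  exact: sqr_ge0.
have {}xD := derivative_from_is_derive xD t0t.
have {}vD := derivative_from_is_derive vD t0t.
have aE : a t = - (alpha / t * v t) - gamma * signed_powR (gamma - 1) (x t).
  by have := ode t (ltW t0t); rewrite /GRing.scale/=; lra.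
exists (gamma * signed_powR (gamma - 1) (x t) * v t); split.
- exact: is_derive1_comp (is_derive_norm_powR (x t) g1) xD.
- have := is_deriveX 2 xD; move=> /is_derive_eq; apply.
  by rewrite /GRing.scale/=; ring.
- have := is_deriveM xD vD; move=> /is_derive_eq; apply.
  rewrite /GRing.scale/= aE -(mul_signed_powR (x t) g1); ring.
- have := is_deriveX 2 vD; move=> /is_derive_eq; apply.
  by rewrite /GRing.scale/= aE; ring.
Qed.

(** The initial data are prescribed at t0, whereas the Lyapunov identities hold
    after t0; right continuity carries the sign of the energy past t0. *)
Lemma derivative_from_cvg_right (R : realType) (t0 : R) (f f' : R -> R) :
  derivative_from t0 f f' -> f @ t0^'+ --> f t0.
Proof.
move=> /(_ t0 (lexx _)) fD.
have qD : (fun s => (s - t0)^-1 *: (f s - f t0)) @ t0^'+ --> f' t0.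
  apply: cvg_trans fD => B; rewrite /= !near_simpl /= => -[d d0 dB].
  exists d => // s sd ts; apply: dB => //=; first by rewrite gt_eqF.
  exact: ltW.
have sD : (fun s => s - t0) @ t0^'+ --> (0 : R).
  rewrite -[X in _ --> X](subrr t0); apply: cvgB; last exact: cvg_cst.
  exact: cvg_at_right_filter.
have : (fun s => (s - t0) * ((s - t0)^-1 *: (f s - f t0)) + f t0) @ t0^'+
    --> 0 * f' t0 + f t0.
  by apply: cvgD; [exact: cvgM | exact: cvg_cst].
rewrite mul0r add0r; apply: cvg_trans; apply: near_eq_cvg.
near=> s; have ts : t0 < s by near: s; exact: nbhs_right_gt.
by rewrite /GRing.scale/= mulVKf ?subrK// subr_eq0 gt_eqF.
Unshelve. all: by end_near. Qed.

(** Starting at time 1 from x = 0 with velocity 1, the energy equals 1/2. *)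
Lemma optimal_rate (R : realType) (gamma alpha : R) :
  1 < gamma -> gamma <= 2 -> 1 + 2 / gamma < alpha ->
  let F := fun y : R => `|y| `^ gamma in
  exists (t0 : R) (x v : R -> R) (K : R),
    [/\ 0 < t0, is_solution (derive1 F) alpha t0 x v, 0 < K &
      forall T : R, 0 < T ->
        exists t : R, [/\ t0 <= t, T <= t &
          K * t `^ (- (2 * gamma * alpha / (gamma + 2)))
            <= F (x t) - minval F]].
Proof.
move=> g1 g2 alphag F.
have g0 : 0 < gamma by lra.
have c0 : 0 < gamma - 1 by lra.
have -> : minval F = 0.
  have F0 : argmin F 0 by move=> y; rewrite /F normr0 powR0 ?gt_eqF// powR_ge0.
  by rewrite (minval_argmin F0) /F normr0 powR0// gt_eqF.
have GC : continuous (derive1 F).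
  rewrite derive1_norm_powR// => y; apply: cvgM; first exact: cvg_cst.
  exact: signed_powR_continuous.
have GL y : `|derive1 F y| <= gamma * (1 + `|y|).
  rewrite derive1_norm_powR// normrM (gtr0_norm g0) ler_pM2l//.
  by apply: signed_powR_growth => //; lra.
have [x [v [sol x0 v0]]] :=
  @damped_solution_exists R (derive1 F) alpha 1 gamma 0 1 ltr01 GC GL.
have [lam [lamE -> lg2]] := rate_exponent g0 alphag.
have M := damped_moments_norm_powR g1 sol.
have [xD [a vD ode]] := sol.
pose E := energy lam (- (lam * (lam * gamma - 2) / 2)) (fun t => F (x t))
  (fun t => x t ^+ 2) (fun t => x t * v t) (fun t => v t ^+ 2).
have E1 : E 1 = 2^-1.
  by rewrite /E /energy /F x0 v0 normr0 powR0 ?gt_eqF//; ring.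
have cE : E @ (1 : R)^'+ --> E 1.
  have cx := derivative_from_cvg_right xD.
  have cv := derivative_from_cvg_right vD.
  have ct : id @ (1 : R)^'+ --> (1 : R) by exact: cvg_at_right_filter.
  have cF : (fun t => F (x t)) @ (1 : R)^'+ --> F (x 1).
    apply: (cvg_comp _ F cx); apply: differentiable_continuous.
    by apply/derivable1_diffP; have [] := is_derive_norm_powR (x 1) g1.
  rewrite /E /energy.
  apply: cvgD; last by apply: cvgM; [exact: cvg_cst | exact: cvgM].
  apply: cvgD; first by apply: cvgM => //; exact: cvgM.
  apply: cvgM; first exact: cvg_cst.
  apply: cvgD; last by apply: cvgM; exact: cvgM.
  apply: cvgD; first by apply: cvgM; [exact: cvg_cst | exact: cvgM].
  by apply: cvgM; [apply: cvgM => //; exact: cvg_cst | exact: cvgM].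
have [t1 [t11 Et1]] : exists t1, 1 < t1 /\ 0 < E t1.
  have E0 : 0 < E 1 by rewrite E1 invr_gt0.
  near (1 : R)^'+ => t1; exists t1; split; first by near: t1; exact: nbhs_right_gt.
  by near: t1; exact: cvgr_gt cE _ E0.
have xD' (t : R) : 1 < t -> is_derive t 1 x (v t).
  by move=> t1t; exact: derivative_from_is_derive xD t1t.
have [K K0 KP] := lower_rate g1 g2 lg2 lamE (@ler01 R) t11 xD' M Et1.
exists 1, x, v, K; split => // T T0.
have [t Tt Kt] := KP (Num.max 1 T).
move: Tt; rewrite ge_max => /andP[t_ge1 Tt].
by exists t; split => //; rewrite subr0.
Unshelve. all: by end_near. Qed.

Theorem theorem4p2 (R : realType) :
  (forall (n : nat) (F : 'rV[R]_n -> R) (gamma alpha t0 : R)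
      (x v : R -> 'rV[R]_n),
    convex_function [set: 'rV[R]_n] F ->
    (forall z, differentiable F z) ->
    argmin F !=set0 ->
    1 <= gamma -> 0 < alpha -> 0 < t0 ->
    well_posed (grad F) alpha t0 ->
    is_solution (grad F) alpha t0 x v ->
    H1 F gamma -> H2 F 2 -> gamma <= 2 ->
    (exists xs, argmin F = [set xs]) ->
    1 + 2 / gamma < alpha ->
    (fun t : R => F (x t) - minval F : R^o) =O_ (pinfty_nbhs R)
      (fun t : R => 1 / t `^ (2 * gamma * alpha / (gamma + 2)) : R^o)) /\
  (forall gamma alpha : R,
    1 < gamma -> gamma <= 2 -> 1 + 2 / gamma < alpha ->
    let F := fun y : R => `|y| `^ gamma in
    exists (t0 : R) (x v : R -> R) (K : R),
      [/\ 0 < t0, is_solution (derive1 F) alpha t0 x v, 0 < K &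
        forall T : R, 0 < T ->
          exists t : R, [/\ t0 <= t, T <= t &
            K * t `^ (- (2 * gamma * alpha / (gamma + 2)))
              <= F (x t) - minval F]]).
Proof.
split; last exact: optimal_rate.
move=> n F gamma alpha t0 x v Fc Fd _ g1 _ t00 _ sol FH1 FH2 g2 [xs argF] alphag.
have [C [T [T0 rate]]] :=
  decay_rate Fc Fd argF g1 g2 t00 alphag sol FH1 FH2.
apply: eqO_decay T0 _ rate => t.
have xsF : argmin F xs by rewrite argF.
by rewrite (minval_argmin xsF) subr_ge0; exact: xsF.
Qed.
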